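(* Let $A$ be a non-empty finite set of positive integers and let $B$ be a finite subset of $\mathbb{Z}$ with $0\in B$ and $\min(A)+\min(B)\ge 0$. Then ${\rm M}(A,B)$ is the smallest (with respect to inclusion) $B$-incentive containing $A$; that is, ${\rm M}(A,B)$ is a $B$-incentive, $A\subseteq {\rm M}(A,B)$, and ${\rm M}(A,B)\subseteq T$ for every $B$-incentive $T$ with $A\subseteq T$.
   Context: $\mathbb{N}$ denotes the non-negative integers. An $(A,B)$-sequence is a list $(x_1,\ldots,x_n)$ of odd finite length $n\geq 1$ such that $x_1,x_3,\ldots,x_n\in A$ and $x_2,x_4,\ldots,x_{n-1}\in B$. Put $|(x_1,\ldots,x_n)|=x_1+\cdots+x_n$ and ${\rm M}(A,B)=\{|x| : x \text{ is an } (A,B)\text{-sequence}\}\cup\{0\}$. For $C\subseteq\mathbb{Z}$, a $C$-incentive is a submonoid $M$ of $(\mathbb{N},+)$ such that $s+t+c\in M$ for all $s,t\in M\setminus\{0\}$ and all $c\in C$. *)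

(* Defs.v *)
From mathcomp Require Import all_boot all_order all_algebra finmap.
From mathcomp Require Import boolp classical_sets.

Set Implicit Arguments.
Unset Strict Implicit.
Unset Printing Implicit Defensive.

Import Order.TTheory GRing.Theory Num.Theory.
Local Open Scope fset_scope.
Local Open Scope classical_set_scope.
Local Open Scope ring_scope.

(* Minimum of a nonempty finite set of integers (see [fset_minP]);
   the junk value for the empty set is 0. *)
Definition fset_min (A : {fset int}) : int :=
  \big[Order.min/head 0 A]_(a <- A) a.

Lemma fset_minP (A : {fset int}) : A != fset0 ->
  fset_min A \in A /\ forall a, a \in A -> fset_min A <= a.
Proof.
move=> /fset0Pn[x xA].
have hA : head 0 A \in A.
  have: x \in enum_fset A by [].
  rewrite -[head 0 A \in A]/(head 0 (enum_fset A) \in enum_fset A).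
  by case: (enum_fset A) => //= y s _; rewrite mem_head.
split; last by move=> a aA; apply: ge_bigmin_seq.
rewrite /fset_min big_seq.
by elim/big_rec: _ => // a m aA mA; rewrite /Order.min; case: ifP.
Qed.

(* The [i]-th entry counted from 0 is the paper's x_(i+1): odd positions of the
   list are the even indices. Lists of odd size are nonempty. *)
Definition AB_sequence (A B : set int) (x : seq int) : Prop :=
  odd (size x) /\
  forall i, (i < size x)%N -> if odd i then B (nth 0 x i) else A (nth 0 x i).

Definition AB_sums (A B : set int) : set int :=
  [set n | exists2 x : seq int, AB_sequence A B x & n = \sum_(a <- x) a]
  `|` [set 0].

(* Submonoids of (N, +), as sets of integers: in [incentive], the element c of C
   may be negative, and s + t + c is computed in Z. *)
Definition nat_submonoid (M : set int) : Prop :=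
  [/\ forall n, M n -> 0 <= n,
      M 0 &
      forall s t, M s -> M t -> M (s + t)].

Definition incentive (C M : set int) : Prop :=
  nat_submonoid M /\
  forall s t c, M s -> s != 0 -> M t -> t != 0 -> C c -> M (s + t + c).

(* Main.v *)
Require Import Defs.
From mathcomp Require Import all_boot all_order all_algebra finmap.
From mathcomp Require Import boolp classical_sets.

Import Order.TTheory GRing.Theory Num.Theory.
Local Open Scope fset_scope.
Local Open Scope classical_set_scope.
Local Open Scope ring_scope.

(** A sequence that is not a single [a] in [A] has the form [a :: b :: y] with
    [y] again an (A,B)-sequence. Since [a + b >= 0], induction along this
    decomposition shows that all sums are positive; hence, for an incentive [T]
    containing [A], both [a] and [|y|] are nonzero elements of [T], and so
    [a + |y| + b] lies in [T]. Conversely, joining two sequences by an entry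
    [c] in [B] realises [s + t + c], and [c = 0] gives closure under sums. *)

Lemma AB_sequence1 (A B : set int) a : A a -> AB_sequence A B [:: a].
Proof. by move=> Aa; split=> // -[]. Qed.

Lemma AB_sequence_cons2 (A B : set int) a b y :
  A a -> B b -> AB_sequence A B y -> AB_sequence A B [:: a, b & y].
Proof.
move=> Aa Bb [odd_y ABy]; split; first by rewrite /= negbK.
by case=> [|[|i]] //= /ABy; rewrite negbK.
Qed.

(** Dropping two entries preserves the parity of all later indices, so the tail [y] is again an
    (A,B)-sequence; the recursion runs on a bound for the length. *)
Lemma AB_sequence_ind (A B : set int) (P : seq int -> Prop) :
  (forall a, A a -> P [:: a]) ->
  (forall a b y, A a -> B b -> AB_sequence A B y -> P y -> P [:: a, b & y]) ->
  forall x, AB_sequence A B x -> P x.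
Proof.
move=> P1 P2 x; have [n] := ubnP (size x).
elim: n x => // n IHn [|a [|b y]] /= lt_n [//= odd_x ABx].
  exact/P1/(ABx 0).
have ABy : AB_sequence A B y.
  split; first by rewrite -(negbK (odd (size y))).
  by move=> i lt_i; have := ABx i.+2 lt_i; rewrite /= negbK.
apply: P2 => //; [exact: (ABx 0)|exact: (ABx 1)|].
by apply: IHn => //; rewrite ltnS in lt_n; exact: ltnW.
Qed.

(** Since [x] has odd length, [c] lands at an odd index and the entries of [y] keep their parity. *)
Lemma AB_sequence_cat (A B : set int) x c y :
  AB_sequence A B x -> B c -> AB_sequence A B y ->
  AB_sequence A B (x ++ c :: y).
Proof.
move=> ABx Bc ABy; elim/AB_sequence_ind: ABx => [a Aa|a b z Aa Bb _ IHz].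
  exact: AB_sequence_cons2.
exact: AB_sequence_cons2.
Qed.

Lemma AB_sequence_sum_gt0 (A B : set int) x :
  (forall a, A a -> 0 < a) -> (forall a b, A a -> B b -> 0 <= a + b) ->
  AB_sequence A B x -> 0 < \sum_(a <- x) a.
Proof.
move=> A_gt0 AB_ge0; elim/AB_sequence_ind=> [a Aa|a b y Aa Bb _ IHy].
  by rewrite big_seq1; exact: A_gt0.
by rewrite !big_cons addrA ltr_wpDl // AB_ge0.
Qed.

Lemma AB_sums_incentive (A B : set int) :
  (forall a, A a -> 0 < a) -> (forall a b, A a -> B b -> 0 <= a + b) -> B 0 ->
  incentive B (AB_sums A B).
Proof.
move=> A_gt0 AB_ge0 B0.
(* Being nonzero rules out the adjoined 0, so [s] and [t] are sums of actual sequences. *)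
have joinP s t c : AB_sums A B s -> s != 0 -> AB_sums A B t -> t != 0 -> B c ->
    AB_sums A B (s + t + c).
  move=> [[x ABx ->]|->]; last by rewrite eqxx.
  move=> _ [[y ABy ->]|->]; last by rewrite eqxx.
  move=> _ Bc; left; exists (x ++ c :: y); first exact: AB_sequence_cat.
  by rewrite big_cat big_cons /= -addrA [c + _]addrC.
split=> //; split.
- by move=> n [[x ABx ->]|-> //]; apply/ltW/(AB_sequence_sum_gt0 A B).
- by right.
- move=> s t Ms Mt.
  have [->|s0] := eqVneq s 0; first by rewrite add0r.
  have [->|t0] := eqVneq t 0; first by rewrite addr0.
  by rewrite -[s + t]addr0; exact: joinP.
Qed.

Lemma sub_AB_sums (A B : set int) : A `<=` AB_sums A B.
Proof.
by move=> a Aa; left; exists [:: a]; [exact: AB_sequence1|rewrite big_seq1].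
Qed.

Lemma AB_sums_min (A B T : set int) :
  (forall a, A a -> 0 < a) -> (forall a b, A a -> B b -> 0 <= a + b) ->
  incentive B T -> A `<=` T -> AB_sums A B `<=` T.
Proof.
move=> A_gt0 AB_ge0 [[_ T0 _] T_inc] AT n [[x ABx ->]|-> //].
elim/AB_sequence_ind: ABx => [a Aa|a b y Aa Bb ABy Ty].
  by rewrite big_seq1; exact: AT.
(* Moving [b] to the end gives the shape that [T_inc] expects. *)
rewrite !big_cons [b + _]addrC addrA.
apply: T_inc => //; [exact: AT|exact/lt0r_neq0/A_gt0|].
exact/lt0r_neq0/(AB_sequence_sum_gt0 A B).
Qed.

Theorem theorem2p6 (A B : {fset int})
    (A_neq0 : A != fset0)
    (A_pos : forall a : int, a \in A -> 0 < a)
    (B_0 : 0 \in B)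
    (minAB : 0 <= fset_min A + fset_min B) :
  [/\ incentive [set` B] (AB_sums [set` A] [set` B]),
      [set` A] `<=` AB_sums [set` A] [set` B] &
      forall T : set int, incentive [set` B] T -> [set` A] `<=` T ->
        AB_sums [set` A] [set` B] `<=` T].
Proof.
(* This makes [fset_min B] a true minimum rather than the default 0, so [minAB] bounds every [a + b]
   from below. *)
have B_neq0 : B != fset0 by apply/fset0Pn; exists 0.
have AB_ge0 a b : [set` A] a -> [set` B] b -> 0 <= a + b.
  move=> Aa Bb; apply: le_trans minAB _; apply: lerD.
    by have [_] := fset_minP A_neq0; apply.
  by have [_] := fset_minP B_neq0; apply.
split; first exact: AB_sums_incentive.
  exact: sub_AB_sums.
by move=> T; exact: AB_sums_min.
Qed.
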